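(* Let $\omega=\omega(n)\le n$ with $\omega\to\infty$, let $p=\omega/n$ and $G=\mathcal{G}(n,p)$. Then a.a.s., for every set-pairing $(S,\mathcal{P})$ with $|S|\ge 510n/\sqrt{\omega}$, there is a nonempty set-pairing $(S',\mathcal{P}')\subseteq(S,\mathcal{P})$ such that the induced subgraph $G[S']$ has a Hamilton path.
   Context: $\mathcal{G}(n,p)$ is the binomial random graph on $[n]$ with each pair an edge independently with probability $p$; a.a.s. means with probability tending to $1$ as $n\to\infty$. A set-pairing is a pair $(S,\mathcal{P})$ where $S\subseteq[n]$ has even size and $\mathcal{P}$ is a partition of $S$ into $|S|/2$ unordered pairs. $(S',\mathcal{P}')\subseteq(S,\mathcal{P})$ means $(S',\mathcal{P}')$ is a set-pairing with $S'\subseteq S$ and $\mathcal{P}'\subseteq\mathcal{P}$. $G[S']$ is the subgraph induced by $S'$. *)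

(* Defs.v *)
From HB Require Import structures.
From mathcomp Require Import all_boot all_order all_algebra.
From mathcomp Require Import all_classical all_reals all_analysis.
Set Implicit Arguments.
Unset Strict Implicit.
Unset Printing Implicit Defensive.
Import Order.TTheory GRing.Theory Num.Theory.
Import numFieldNormedType.Exports.
Local Open Scope ring_scope.

Definition vpairs (T : finType) : {set {set T}} := [set e : {set T} | #|e| == 2].

(* A graph on T is given by its edge set, a subset of vpairs T. *)
Definition adj (T : finType) (E : {set {set T}}) : rel T :=
  fun x y => [set x; y]%SET \in E.

Definition induced_edges (T : finType) (E : {set {set T}}) (V : {set T}) :
  {set {set T}} := [set e in E | e \subset V].

(* V is the vertex set and s the list of vertices in the order of the path. *)
Definition is_hamilton_path (T : finType) (V : {set T}) (E : {set {set T}})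
    (s : seq T) : bool :=
  [&& uniq s, [set x in s]%SET == V & sorted (adj E) s].

Definition is_set_pairing (T : finType) (S : {set T}) (P : {set {set T}}) : bool :=
  [&& ~~ odd #|S|, finset.partition P S, #|P| == #|S|./2 & P \subset vpairs T].

(* The law of G(n,p) as a product of independent Bernoulli(p) edge indicators;
   these are probability weights when 0 <= p <= 1. *)
Definition gnp_weight (R : realType) (n : nat) (p : R) (E : {set {set 'I_n}}) : R :=
  \prod_(e in vpairs 'I_n) (if e \in E then p else 1 - p).

Definition gnp_prob (R : realType) (n : nat) (p : R)
    (A : set {set {set 'I_n}}) : R :=
  \sum_(E in powerset (vpairs 'I_n) | E \in A) gnp_weight p E.

Definition aas (R : realType) (p : nat -> R)
    (A : forall n : nat, set {set {set 'I_n}}) : Prop :=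
  (gnp_prob (p n) (A n) @[n --> \oo] --> (1 : R))%classic.

(* Main.v *)
(* Expose G(n,p) as the union of two independent copies E1, E2 of G(n,q), where
   1 - p = (1 - q)^2, and let m = 3n/sqrt(omega) up to rounding.
   With high probability any two disjoint m-sets span an edge of E1. Given a
   set-pairing of size at least 100m, take a maximal set X of at most m vertices
   that expands badly into the pairs it avoids, and discard all pairs meeting X:
   what remains is a sub-pairing S' on which E1 is an expander.
   By Posa's rotations, for every expander on S' the pairs that close some
   longest path to a cycle ("boosters") number at least |S'|^2/32. If
   (E1 u E2)[S'] has no Hamilton path, let F be the set of edges of E2 on one of
   its longest paths; then no booster of E1 u F lies in E2. For fixed E1, S' and
   F this has probability at most q^|F| (1-q)^(|S'|^2/32). As |F| <= |S'|, the
   sum over F is at most 32^|S'| (1+q/32)^(|S'|^2/2) (1-q)^(|S'|^2/32), which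
   beats the 2^n choices of S'; the pairing never enters the union bound. *)
Require Import Defs.
From HB Require Import structures.
From mathcomp Require Import all_boot all_order all_algebra.
From mathcomp Require Import all_classical all_reals all_analysis.
From mathcomp Require Import zify ring lra.
Set Implicit Arguments.
Unset Strict Implicit.
Unset Printing Implicit Defensive.
Import Order.TTheory GRing.Theory Num.Theory.
Import numFieldNormedType.Exports.
Local Open Scope ring_scope.

(** * Consecutive entries of a sequence *)

Fixpoint consec (T : Type) (s : seq T) (u w : T) : Prop :=
  if s is x :: s' then
    (if s' is y :: _ then x = u /\ y = w else False) \/ consec s' u w
  else False.

Lemma consec_cat (T : Type) (s t : seq T) y z u w :
  consec (rcons s y ++ z :: t) u w <->
  consec (rcons s y) u w \/ (u = y /\ w = z) \/ consec (z :: t) u w.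
Proof.
elim: s => [|x s IHs].
  rewrite /=; split; first by case=> [[-> ->]|h]; tauto.
  by case=> [[[]|[]]|[[-> ->]|h]]; tauto.
have -> : consec (rcons (x :: s) y ++ z :: t) u w <->
    (x = u /\ head y s = w) \/ consec (rcons s y ++ z :: t) u w.
  by case: s {IHs}.
have -> : consec (rcons (x :: s) y) u w <->
    (x = u /\ head y s = w) \/ consec (rcons s y) u w.
  by case: s {IHs}.
by rewrite IHs; tauto.
Qed.

Lemma consec_rev (T : Type) (s : seq T) u w :
  consec (rev s) u w <-> consec s w u.
Proof.
elim: s => [|x [|y s] IHs] //.
rewrite rev_cons rev_cons -cats1 consec_cat -rev_cons IHs /=.
split.
  by case=> [h|[[-> ->]|[[]|[]]]]; [right | left].
by case=> [[<- <-]|h]; tauto.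
Qed.

Lemma sorted_consec (T : Type) (e : rel T) (s : seq T) :
  sorted e s <-> forall u w, consec s u w -> e u w.
Proof.
elim: s => [|x [|y s] IHs] //=.
  by split=> // _ u w [[]|[]].
split.
  by case/andP=> exy /IHs h u w [[<- <-] //|]; apply: h.
move=> h; apply/andP; split; first by apply: h; left.
by apply/IHs => u w huw; apply: h; right.
Qed.

Lemma consec_mem (T : eqType) (s : seq T) u w :
  consec s u w -> (u \in s) /\ (w \in s).
Proof.
elim: s => [|x [|y s] IHs] //=; first by case=> [[]|[]].
rewrite inE [w \in _]inE.
by case=> [[-> ->]|/IHs [-> ->]]; rewrite ?inE ?eqxx ?orbT.
Qed.

Lemma consec_index (T : eqType) (s : seq T) u w : uniq s -> consec s u w ->
  index w s = (index u s).+1.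
Proof.
elim: s => [|x s IHs] //= /andP [xs us].
case=> [|huw].
  case: s {IHs us} xs => [|y s] //= xs [<- <-].
  rewrite !eqxx; case: eqP xs => [->|_ _] //.
  by rewrite inE eqxx.
have [us' ws'] := consec_mem huw.
have [-> ->] : (x == u) = false /\ (x == w) = false.
  by split; apply/eqP => xE; rewrite xE ?us' ?ws' in xs.
by rewrite (IHs us huw).
Qed.

(** * Longest paths and Posa's rotations *)

Lemma adjC (T : finType) (E : {set {set T}}) x y : adj E x y = adj E y x.
Proof. by rewrite /adj finset.setUC. Qed.

Definition path_in (T : finType) (E : {set {set T}}) (A : {set T}) (s : seq T) : bool :=
  [&& uniq s, all (fun x => x \in A) s & sorted (adj E) s].

Definition longest (T : finType) (E : {set {set T}}) (A : {set T}) (s : seq T) : Prop :=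
  path_in E A s /\ forall t, path_in E A t -> (size t <= size s)%N.

Definition ext_nbrs (T : finType) (E : {set {set T}}) (A X : {set T}) : {set T} :=
  [set y in A :\: X | [exists x in X, adj E x y]]%SET.

(** Posa's rotations with the first vertex kept fixed: the chord from [y] to the current end
    replaces the edge from [y] to [z], and [z] becomes the new end. *)
Inductive rotation (T : finType) (E : {set {set T}}) (s0 : seq T) : seq T -> Prop :=
| rotation0 : rotation E s0 s0
| rotationS s y z t : rotation E s0 (rcons s y ++ z :: t) ->
    adj E y (last z t) -> rotation E s0 (rcons s y ++ rev (z :: t)).

Lemma path_in_rev (T : finType) (E : {set {set T}}) (A : {set T}) s :
  path_in E A (rev s) = path_in E A s.
Proof.
rewrite /path_in rev_uniq all_rev rev_sorted; congr [&& _, _ & _].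
by apply: eq_sorted => x y; rewrite adjC.
Qed.

Lemma path_in_rotate (T : finType) (E : {set {set T}}) (A : {set T}) s y z t :
  path_in E A (rcons s y ++ z :: t) -> adj E y (last z t) ->
  path_in E A (rcons s y ++ rev (z :: t)).
Proof.
case/and3P=> us As /sorted_consec hs eyz; apply/and3P; split.
- move: us; rewrite !cat_uniq rev_uniq; congr [&& _, ~~ _ & _].
  by apply: eq_has_r => u; rewrite mem_rev.
- by move: As; rewrite !all_cat all_rev.
apply/sorted_consec => u w; rewrite {1}lastI rev_rcons consec_cat -rev_rcons -lastI.
case=> [h|[[-> ->] //|/consec_rev h]].
  by apply: hs; apply/consec_cat; left.
by rewrite adjC; apply: hs; apply/consec_cat; right; right.
Qed.

Lemma rotation_path (T : finType) (E : {set {set T}}) (A : {set T}) s0 s x0 :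
  path_in E A s0 -> rotation E s0 s ->
  [/\ path_in E A s, size s = size s0 & head x0 s = head x0 s0].
Proof.
move=> p0; elim=> // {}s y z t _ [ps ss hs] eyz; split.
- exact: path_in_rotate.
- by rewrite -ss !size_cat size_rev.
- by rewrite -hs; case: (s).
Qed.

Definition rotation_ends (T : finType) (E : {set {set T}}) (x0 : T) (s0 : seq T) : {set T} :=
  [set x | `[< exists2 s, rotation E s0 s & last x0 s = x >]]%SET.

(* When a rotation replaces an edge at [y] by the one to the current end, the
   other endpoint of the lost edge becomes an end. *)
Lemma rotation_edges (T : finType) (E : {set {set T}}) x0 s0 s u w :
  rotation E s0 s -> u \notin rotation_ends E x0 s0 ->
  consec s u w \/ consec s w u ->
  (consec s0 u w \/ consec s0 w u) \/
  exists2 r, r \in rotation_ends E x0 s0 & consec s0 u r \/ consec s0 r u.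
Proof.
move=> rs uR; elim: rs w => [w|{}s y z t rs IHs eyz w]; first by left.
have lR : last z t \in rotation_ends E x0 s0.
  rewrite inE; apply/asboolP; exists (rcons s y ++ z :: t) => //.
  by rewrite last_cat.
have zR : z \in rotation_ends E x0 s0.
  rewrite inE; apply/asboolP; exists (rcons s y ++ rev (z :: t)).
    exact: rotationS.
  by rewrite last_cat rev_cons last_rcons.
rewrite {1 2}lastI rev_rcons !consec_cat -rev_rcons -lastI !consec_rev.
have old v : consec (rcons s y ++ z :: t) u v \/ consec (rcons s y ++ z :: t) v u ->
  (consec s0 u v \/ consec s0 v u) \/
  exists2 r, r \in rotation_ends E x0 s0 & consec s0 u r \/ consec s0 r u.
  exact: IHs.
(* The pair of [y] and [last z t] is new on the path. The pair of [y] and [z], which the rotation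
   destroys, serves in its place, because [z] is now an end. *)
have oldz : u = y -> (consec s0 u w \/ consec s0 w u) \/
  exists2 r, r \in rotation_ends E x0 s0 & consec s0 u r \/ consec s0 r u.
  move=> uy; case: (old z) => [|h|h]; last by right.
    by left; apply/consec_cat; right; left.
  by right; exists z.
case=> [[h|[[uy _]|h]]|[h|[[_ ul]|h]]].
- by apply: old; left; apply/consec_cat; left.
- exact: oldz.
- by apply: old; right; apply/consec_cat; right; right.
- by apply: old; right; apply/consec_cat; left.
- by rewrite ul lR in uR.
- by apply: old; left; apply/consec_cat; right; right.
Qed.

(** A neighbour [y] of an end lies on the rotated path, which could otherwise be extended. Rotating
    at [y] makes its successor [z] an end. Either [y] and [z] were already consecutive on [s0], or
    an earlier rotation broke an edge of [s0] at [y] and so made its other endpoint an end. *)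
Lemma rotation_ends_nbrs (T : finType) (E : {set {set T}}) (A : {set T}) x0 s0 y :
  longest E A s0 -> y \in ext_nbrs E A (rotation_ends E x0 s0) ->
  exists2 r, r \in rotation_ends E x0 s0 & consec s0 y r \/ consec s0 r y.
Proof.
move=> [p0 max0]; rewrite inE => /andP [/setDP [yA yR]].
case/exists_inP=> x xR exy; move: (xR); rewrite inE => /asboolP [s rs lx].
have [ps ss _] := rotation_path x0 p0 rs.
have s_gt0 : (0 < size s)%N.
  rewrite ss; apply: leq_trans (max0 [:: y] _) => //.
  by rewrite /path_in /= yA.
case: (boolP (y \in s)) => ys; last first.
  have : path_in E A (rcons s y).
    case/and3P: ps => us As ss'; rewrite /path_in rcons_uniq ys us all_rcons yA As /=.
    by case: (s) lx ss' => //= a s' lx'; rewrite rcons_path lx' exy andbT.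
  by move/max0; rewrite size_rcons ss ltnn.
case/splitPr: ys rs lx => s1 [|z t] rs lx.
  by rewrite -lx last_cat /= in xR; rewrite xR in yR.
rewrite -cat_rcons in rs lx.
rewrite last_cat /= in lx.
have zR : z \in rotation_ends E x0 s0.
  rewrite inE; apply/asboolP; exists (rcons s1 y ++ rev (z :: t)).
    by apply: rotationS => //; rewrite lx adjC.
  by rewrite last_cat rev_cons last_rcons.
case: (rotation_edges (w := z) rs yR) => // [|h].
  by left; apply/consec_cat; right; left.
by exists z.
Qed.

(** Each of these neighbours comes directly before or directly after an end on [s0], and every end
    has at most one predecessor and one successor there. *)
Lemma card_rotation_ends_nbrs (T : finType) (E : {set {set T}}) (A : {set T}) x0 s0 :
  longest E A s0 ->
  (#|ext_nbrs E A (rotation_ends E x0 s0)| <= 2 * #|rotation_ends E x0 s0|)%N.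
Proof.
move=> l0; have [/and3P [us0 _ _] _] := l0.
set R := rotation_ends E x0 s0.
pose nx r := nth x0 s0 (index r s0).+1; pose pv r := nth x0 s0 (index r s0).-1.
apply: leq_trans (_ : #|(nx @: R) :|: (pv @: R)|%SET <= _)%N; last first.
  apply: leq_trans (leq_card_setU _ _) _.
  by rewrite mul2n -addnn leq_add // leq_imset_card.
apply: subset_leq_card; apply/fintype.subsetP => y /(rotation_ends_nbrs l0) [r rR].
case=> h; rewrite inE; apply/orP; [right | left]; apply/imsetP; exists r => //.
  by rewrite /pv (consec_index us0 h) /= nth_index //; case: (consec_mem h).
by rewrite /nx -(consec_index us0 h) /= nth_index //; case: (consec_mem h).
Qed.

(** * Expanders, boosters and Hamilton paths *)

Definition expander (T : finType) (E : {set {set T}}) (A : {set T}) : Prop :=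
  forall X : {set T}, X \subset A -> X != finset.set0 -> (4 * #|X| <= #|A|)%N ->
    (2 * #|X| < #|ext_nbrs E A X|)%N.

(** Connectedness of the graph on [A], expressed through cuts. *)
Definition linked (T : finType) (E : {set {set T}}) (A : {set T}) : Prop :=
  forall X : {set T}, X \subset A -> X != finset.set0 -> X != A ->
    ext_nbrs E A X != finset.set0.

Lemma ext_nbrs_mono (T : finType) (E E' : {set {set T}}) (A X : {set T}) :
  E \subset E' -> ext_nbrs E A X \subset ext_nbrs E' A X.
Proof.
move=> EE'; apply/fintype.subsetP => y; rewrite !inE.
case/andP=> -> /exists_inP [x xX exy] /=; apply/exists_inP; exists x => //.
exact: (fintype.subsetP EE').
Qed.

Lemma expander_mono (T : finType) (E E' : {set {set T}}) (A : {set T}) :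
  E \subset E' -> expander E A -> expander E' A.
Proof.
move=> EE' hE X XA X0 cX; apply: leq_trans (hE X XA X0 cX) _.
exact/subset_leq_card/ext_nbrs_mono.
Qed.

Lemma linked_mono (T : finType) (E E' : {set {set T}}) (A : {set T}) :
  E \subset E' -> linked E A -> linked E' A.
Proof.
move=> EE' hE X XA X0 X1; move: (hE X XA X0 X1).
by apply: contraNneq => h; rewrite -finset.subset0 -h; apply: ext_nbrs_mono.
Qed.

Lemma path_in_mono (T : finType) (E E' : {set {set T}}) (A : {set T}) s :
  E \subset E' -> path_in E A s -> path_in E' A s.
Proof.
move=> EE' /and3P [us As ss]; rewrite /path_in us As /=.
by apply: sub_sorted ss => x y; apply: (fintype.subsetP EE').
Qed.

Lemma exists_longest (T : finType) (E : {set {set T}}) (A : {set T}) :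
  exists s, longest E A s.
Proof.
pose P i := `[< exists2 s, path_in E A s & size s = i >].
have exP : exists i, P i by exists 0; apply/asboolP; exists [::].
have ubP i : P i -> (i <= #|T|)%N.
  move=> /asboolP [s /and3P [us _ _] <-].
  by rewrite -(card_uniqP us) max_card.
case: (ex_maxnP exP ubP) => i /asboolP [s ps <-] max; exists s; split=> // t pt.
by apply: max; apply/asboolP; exists t.
Qed.

Definition longest_ends (T : finType) (E : {set {set T}}) (A : {set T}) (x : T) : {set T} :=
  [set y | `[< exists2 t, longest E A (x :: t) & last x t = y >]]%SET.

(** Rotations keep the length and the first vertex, so every rotation end counts. If these ends
    filled at most a quarter of [A], they would have more than twice as many outer neighbours,
    against the bound for rotation ends. *)
Lemma card_longest_ends (T : finType) (E : {set {set T}}) (A : {set T}) x s :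
  expander E A -> longest E A (x :: s) -> (#|A| < 4 * #|longest_ends E A x|)%N.
Proof.
move=> hE l0; have [p0 max0] := l0.
set R := rotation_ends E x (x :: s).
have RS : R \subset longest_ends E A x.
  apply/fintype.subsetP => y; rewrite inE => /asboolP [t rt <-].
  have [pt st ht] := rotation_path x p0 rt.
  case: t rt pt st ht => // a t _ pt st /= ax; rewrite ax in pt *.
  rewrite inE; apply/asboolP; exists t => //; split=> // t' /max0.
  by rewrite -st.
apply: leq_trans (_ : 4 * #|R| <= _)%N; last by rewrite leq_mul2l subset_leq_card.
rewrite ltnNge; apply/negP => cR.
have RA : R \subset A.
  apply/fintype.subsetP => y; rewrite inE => /asboolP [t rt <-].
  have [/and3P [_ At _] st _] := rotation_path x p0 rt.
  by apply: (allP At); case: t st {rt At} => // a t _ /=; rewrite mem_last.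
have R0 : R != finset.set0.
  apply/finset.set0Pn; exists (last x s); rewrite inE; apply/asboolP.
  by exists (x :: s) => //; apply: rotation0.
have := hE R RA R0 cR; rewrite ltnNge => /negP; apply.
exact: card_rotation_ends_nbrs.
Qed.

Lemma longest_rev (T : finType) (E : {set {set T}}) (A : {set T}) s :
  longest E A s -> longest E A (rev s).
Proof. by case=> ps ms; split; rewrite ?path_in_rev ?size_rev. Qed.

(** A booster may already be an edge of [E]; what matters is that its presence closes a longest path
    to a cycle. *)
Definition boosters (T : finType) (E : {set {set T}}) (A : {set T}) : {set {set T}} :=
  [set e in vpairs T | `[< exists x t, longest E A (x :: t) /\ e = [set x; last x t]%SET >]]%SET.

(** A fixed first vertex gives more than [#|A| / 4] ends. Reversing the paths makes each of these a
    first vertex, with more than [#|A| / 4] ends of its own. This yields at least [#|A|^2 / 16]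
    ordered pairs, and an unordered pair is counted at most twice. *)
Lemma card_boosters (T : finType) (E : {set {set T}}) (A : {set T}) :
  expander E A -> (4 <= #|A|)%N -> (#|A| * #|A| <= 32 * #|boosters E A|)%N.
Proof.
move=> hE cA.
have [Q lQ] := exists_longest E A; have [_ maxQ] := lQ.
(* A longest path has at least two vertices, since expansion gives a single vertex a neighbour.
   Hence its two ends differ and form a genuine pair. *)
have Q2 : (1 < size Q)%N.
  have [v vA] : exists v, v \in A by apply/card_gt0P; lia.
  have : (2 * #|[set v]%SET| < #|ext_nbrs E A [set v]%SET|)%N.
    apply: hE; rewrite ?finset.sub1set ?cards1 //.
    by apply/finset.set0Pn; exists v; rewrite inE.
  case: (set_0Vmem (ext_nbrs E A [set v]%SET)) => [->|[y]]; first by rewrite cards0.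
  rewrite inE => /andP [/setDP [yA yv] /exists_inP [x]]; rewrite inE => /eqP -> vy _.
  apply: leq_trans (maxQ [:: v; y] _) => //.
  by rewrite /path_in /= vA yA vy mem_seq1 eq_sym; rewrite inE in yv; rewrite yv.
pose O := [set p : T * T | p.2 \in longest_ends E A p.1]%SET.
have cO : (#|A| * #|A| <= 16 * #|O|)%N.
  have -> : #|O| = (\sum_x #|longest_ends E A x|)%N.
    transitivity (\sum_x \sum_(y | y \in longest_ends E A x) 1)%N.
      by rewrite pair_big_dep /= -sum1_card; apply: eq_bigl => p; rewrite inE.
    by apply: eq_bigr => x _; rewrite sum1_card.
  case: Q lQ Q2 {maxQ} => // a s lQ _.
  have cR := card_longest_ends hE lQ.
  apply: leq_trans (_ : 16 * \sum_(x in longest_ends E A a) #|longest_ends E A x| <= _)%N;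
    last by rewrite leq_mul2l /= [X in (_ <= X)%N](bigID (mem (longest_ends E A a))) leq_addr.
  apply: leq_trans (_ : 4 * \sum_(x in longest_ends E A a) #|A| <= _)%N.
    by rewrite sum_nat_const mulnA leq_mul2r (ltnW cR) orbT.
  rewrite (_ : 16 = 4 * 4)%N // -mulnA leq_mul2l /= big_distrr /=.
  apply: leq_sum => x; rewrite inE => /asboolP [t /longest_rev lt <-].
  rewrite lastI rev_rcons in lt.
  exact: ltnW (card_longest_ends hE lt).
apply: leq_trans cO _.
rewrite (_ : 32 = 16 * 2)%N // -mulnA leq_mul2l /= mulnC.
rewrite (_ : 2 = #|[set: bool]%SET|)%N; last by rewrite cardsT card_bool.
rewrite -cardsX.
(* The boolean records the orientation of the ordered pair, which makes [f] injective and accounts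
   for the factor 2. *)
pose f (p : T * T) := ([set p.1; p.2]%SET, (enum_rank p.1 < enum_rank p.2)%N).
have Oneq x y : (x, y) \in O -> x != y.
  rewrite inE inE /= => /asboolP [t [pt mt] <-].
  have : (size Q <= size (x :: t))%N by apply: mt; case: lQ.
  case: t pt {mt} => [|b t] pt /=; first by move=> h; have := leq_trans Q2 h.
  move=> _; case/and3P: pt => /= /andP [xt _] _ _.
  by apply: contraNneq xt => {1}->; apply: mem_last.
have f_inj : {in O &, injective f}.
  move=> [x y] [x' y'] /Oneq xy /Oneq xy' [] /=.
  move=> /setP e r.
  have e1 : (x == x') || (x == y') by have := e x; rewrite !inE eqxx /= => <-.
  have e2 : (y == x') || (y == y') by have := e y; rewrite !inE eqxx orbT /= => <-.
  case/orP: e1 => /eqP xE.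
    by case/orP: e2 => /eqP yE; [rewrite xE yE eqxx in xy | rewrite xE yE].
  case/orP: e2 => /eqP yE; last by rewrite xE yE eqxx in xy.
  subst x' y'; move: r; case: ltngtP => // /val_inj /enum_rank_inj xE.
  by rewrite xE eqxx in xy.
rewrite -(card_in_imset f_inj); apply: subset_leq_card.
apply/fintype.subsetP => _ /imsetP [[x y] xyO ->].
have xy := Oneq _ _ xyO.
rewrite /f /= !inE /= andbT cards2 xy eqxx /=.
move: xyO; rewrite inE inE /= => /asboolP [t lt <-].
by apply/asboolP; exists x, t.
Qed.

(** If the cycle missed a vertex of [A], some [y] outside it would be adjacent to a vertex [u] on
    it. Opening the cycle at [u] and putting [y] in front would give a longer path. *)
Lemma longest_closed (T : finType) (E : {set {set T}}) (A : {set T}) x t :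
  linked E A -> longest E A (x :: t) -> adj E x (last x t) ->
  [set z in x :: t]%SET = A.
Proof.
move=> hE [/and3P [us As ss] ms] exl; apply/eqP; apply: contraT => nA.
have : ext_nbrs E A [set z in x :: t]%SET != finset.set0.
  apply: hE => //.
    by apply/fintype.subsetP => z; rewrite inE => /(allP As).
  by apply/finset.set0Pn; exists x; rewrite inE mem_head.
case/finset.set0Pn=> y; rewrite inE => /andP [/setDP [yA yX]].
case/exists_inP=> u; rewrite inE => uX euy; rewrite inE in yX.
have [i s' rs] := rot_to uX.
have cyc : cycle (adj E) (x :: t) by rewrite /= rcons_path; move: ss => /= ->; rewrite adjC.
have /ms : path_in E A (y :: u :: s').
  rewrite -rs /path_in /= mem_rot yX rot_uniq us yA /=.
  rewrite (eq_all_r (mem_rot i (x :: t))) As rs /= adjC euy /=.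
  by move: cyc; rewrite -(rot_cycle i) rs /= rcons_path => /andP [].
by rewrite /= -[(size s').+1]/(size (u :: s')) -rs size_rot ltnn.
Qed.

Lemma path_in_hamilton (T : finType) (E : {set {set T}}) (A : {set T}) s :
  path_in E A s -> [set z in s]%SET = A ->
  is_hamilton_path A (induced_edges E A) s.
Proof.
case/and3P=> us As /sorted_consec ss sA; rewrite /is_hamilton_path us sA eqxx /=.
apply/sorted_consec => u w huw; have [uS wS] := consec_mem huw.
rewrite /adj inE; apply/andP; split; first exact: ss.
by apply/fintype.subsetP => z; rewrite !inE => /orP [] /eqP ->; apply: (allP As).
Qed.

(** The longest path [Q] of the union survives in [E1 :|: F], so longest paths have the same length
    in both graphs. A booster of [E1 :|: F] lying in [E2] would therefore close a longest path of
    the union to a cycle, which connectedness turns into a Hamilton path. *)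
Lemma no_hamilton_boosters (T : finType) (E1 E2 : {set {set T}}) (A : {set T}) :
  linked E1 A ->
  (forall s, ~ is_hamilton_path A (induced_edges (E1 :|: E2)%SET A) s) ->
  exists F : {set {set T}},
    [/\ F \subset induced_edges (vpairs T) A, (#|F| <= #|A|)%N, F \subset E2 &
        [disjoint E2 & boosters (E1 :|: F)%SET A]].
Proof.
move=> hE noH; have [Q [pQ mQ]] := exists_longest (E1 :|: E2)%SET A.
have /and3P [uQ AQ sQ] := pQ.
pose F := [set e in E2 | `[< exists u w, consec Q u w /\ e = [set u; w]%SET >]]%SET.
have FE2 : F \subset E2 by apply/fintype.subsetP => e; rewrite inE => /andP [].
have sub : (E1 :|: F \subset E1 :|: E2)%SET by apply: finset.setUS.
exists F; split=> //.
- apply/fintype.subsetP => e; rewrite inE => /andP [_ /asboolP [u [w [huw ->]]]].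
  have [uS wS] := consec_mem huw.
  rewrite !inE cards2; apply/andP; split.
    by have := consec_index uQ huw; case: (eqVneq u w) => // ->; lia.
  by apply/fintype.subsetP => z; rewrite !inE => /orP [] /eqP ->; apply: (allP AQ).
(* An edge of the path is determined by its first vertex, which lies in [A]. *)
- pose g u := [set u; nth u Q (index u Q).+1]%SET.
  apply: leq_trans (_ : #|(g @: A)%SET| <= _)%N; last exact: leq_imset_card.
  apply: subset_leq_card; apply/fintype.subsetP => e.
  rewrite inE => /andP [_ /asboolP [u [w [huw ->]]]].
  have [uS wS] := consec_mem huw.
  apply/imsetP; exists u; first exact: (allP AQ).
  by rewrite /g -(consec_index uQ huw) nth_index.
have pQF : path_in (E1 :|: F)%SET A Q.
  rewrite /path_in uQ AQ /=; apply/sorted_consec => u w huw.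
  move/sorted_consec/(_ u w huw): sQ; rewrite /adj !inE => /orP [-> //|h].
  by rewrite h; apply/orP; right; apply/asboolP; exists u, w.
apply/pred0P => e; apply/negbTE/negP => /andP [/= eE2].
rewrite inE => /andP [_ /asboolP [x [t [[pt mt] eE]]]].
have lt : longest (E1 :|: E2)%SET A (x :: t).
  by split=> [|t' /mQ h]; [exact: path_in_mono pt | exact: leq_trans h (mt Q pQF)].
apply: (noH (x :: t)); apply: path_in_hamilton; first by case: lt.
apply: longest_closed lt _; first exact: linked_mono (finset.subsetUl _ _) hE.
by rewrite /adj -eE inE eE2 orbT.
Qed.

(** * Sub-pairings that carry an expander *)

Lemma sub_set_pairing (T : finType) (S : {set T}) (P P' : {set {set T}}) :
  is_set_pairing S P -> P' \subset P ->
  [/\ is_set_pairing (finset.cover P') P', finset.cover P' \subset S &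
      #|finset.cover P'| = (2 * #|P'|)%N].
Proof.
case/and4P=> _ /and3P [/eqP cP tP P0] _ vP P'P.
have tP' := trivIsetS P'P tP.
have cP' : #|finset.cover P'| = (2 * #|P'|)%N.
  rewrite mulnC; apply: card_uniform_partition (_ : finset.partition P' _).
    by move=> e /(fintype.subsetP P'P) /(fintype.subsetP vP); rewrite inE => /eqP.
  rewrite /finset.partition eqxx tP' /=.
  by apply: contra P0; apply: (fintype.subsetP P'P).
split=> //.
  rewrite /is_set_pairing cP' mul2n odd_double doubleK eqxx /= andbC.
  rewrite (fintype.subset_trans P'P vP) /= /finset.partition eqxx tP' /=.
  by apply: contra P0; apply: (fintype.subsetP P'P).
rewrite -cP; apply/finset.bigcupsP => e eP'.
by apply: finset.bigcup_sup; apply: (fintype.subsetP P'P).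
Qed.

Definition pairs_avoiding (T : finType) (P : {set {set T}}) (X : {set T}) : {set {set T}} :=
  [set e in P | [disjoint e & X]]%SET.

(** Each discarded pair is the block of some vertex of [X], so at most [#|X|] pairs are lost, with
    two vertices each. *)
Lemma card_cover_avoiding (T : finType) (S : {set T}) (P : {set {set T}}) (X : {set T}) :
  is_set_pairing S P -> (#|S| <= #|finset.cover (pairs_avoiding P X)| + 2 * #|X|)%N.
Proof.
move=> hP; have [_ /and3P [/eqP cP tP _] _ _] := and4P hP.
have sP : pairs_avoiding P X \subset P by apply/fintype.subsetP => e; rewrite inE => /andP [].
have [_ _ ->] := sub_set_pairing hP sP.
have [_ _] := sub_set_pairing hP (fintype.subxx P); rewrite cP => ->.
rewrite -mulnDr leq_mul2l /=.
rewrite -(cardsID (pairs_avoiding P X) P) (finset.setIidPr sP) leq_add2l.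
apply: leq_trans (_ : #|(finset.pblock P @: X)%SET| <= _)%N; last exact: leq_imset_card.
apply: subset_leq_card; apply/fintype.subsetP => e.
rewrite inE => /andP [eA eP]; move: eA; rewrite inE eP /=.
case/pred0Pn=> x /andP [/= xe xX]; apply/imsetP; exists x => //.
by rewrite (finset.def_pblock tP eP xe).
Qed.

Definition joined (T : finType) (E : {set {set T}}) (m : nat) : Prop :=
  forall A B : {set T}, [disjoint A & B] -> (m <= #|A|)%N -> (m <= #|B|)%N ->
  exists x y, [/\ x \in A, y \in B & adj E x y].

(** The vertices of [A] outside [X] and its neighbourhood send no edge to [X], so there are fewer
    than [m] of them. *)
Lemma joined_ext_nbrs (T : finType) (E : {set {set T}}) (m : nat) (A X : {set T}) :
  joined E m -> (m <= #|X|)%N -> (#|A| < #|A :&: X| + #|ext_nbrs E A X| + m)%N.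
Proof.
move=> hE cX; rewrite -(cardsID X A) -addnA ltn_add2l.
have sub : ext_nbrs E A X \subset (A :\: X)%SET.
  by apply/fintype.subsetP => y; rewrite inE => /andP [].
rewrite -(cardsID (ext_nbrs E A X)) (finset.setIidPr sub) ltn_add2l ltnNge.
apply/negP => cZ; have [|x [y [xX yZ exy]]] := hE X (A :\: X :\: ext_nbrs E A X)%SET _ cX cZ.
  apply/pred0P => x; apply/negbTE/negP => /andP [/= xX].
  by rewrite !inE xX andbF.
move: yZ; rewrite inE => /andP [yN yAX]; case/negP: yN.
by rewrite inE yAX; apply/exists_inP; exists x.
Qed.

(** Across an empty cut, expansion forces both sides to exceed a quarter of [A], hence to have at
    least [m] vertices; then [joined] supplies a crossing edge. *)
Lemma joined_linked (T : finType) (E : {set {set T}}) (m : nat) (A : {set T}) :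
  joined E m -> (4 * m <= #|A|)%N -> expander E A -> linked E A.
Proof.
move=> jE cA hE X XA X0 X1; apply/negP => /eqP N0.
have cX : (#|A| < 4 * #|X|)%N.
  by rewrite ltnNge; apply/negP => /(hE X XA X0); rewrite N0 cards0.
have dE x y : x \in X -> y \in (A :\: X)%SET -> adj E x y -> False.
  move=> xX yX exy; have : y \in ext_nbrs E A X.
    by rewrite inE yX; apply/exists_inP; exists x.
  by rewrite N0 inE.
have cY : (#|A| < 4 * #|(A :\: X)%SET|)%N.
  rewrite ltnNge; apply/negP => /hE.
  have -> : ext_nbrs E A (A :\: X)%SET = finset.set0.
    apply/eqP; rewrite -finset.subset0; apply/fintype.subsetP => x.
    rewrite inE => /andP [/finset.setDP [xA]]; rewrite inE xA andbT negbK => xX.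
    by case/exists_inP=> y yX; rewrite adjC => /(dE _ _ xX yX).
  rewrite cards0 ltn0 => h; suff : false by [].
  apply: h; first exact: finset.subsetDl.
  apply: contra X1; by rewrite finset.setD_eq0 finset.eqEsubset XA => ->.
have [|||x [y [xX yX exy]]] := jE X (A :\: X)%SET; try lia.
- apply/pred0P => x; apply/negbTE/negP => /andP [/= xX].
  by rewrite !inE xX.
- exact: dE xX yX exy.
Qed.

(** Enlarging [X] shrinks [rest X], so poor expansion of [X] and of a disjoint [Y] inside [rest X]
    passes to their union. The union thus contradicts either the maximality of [X] or, once larger
    than [m], the edges given by [joined]. *)
Lemma expanding_subpairing (T : finType) (E : {set {set T}}) (m : nat)
    (S : {set T}) (P : {set {set T}}) :
  joined E m -> is_set_pairing S P -> (9 * m <= #|S|)%N ->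
  exists (S' : {set T}) (P' : {set {set T}}),
    [/\ is_set_pairing S' P', S' \subset S, P' \subset P, (#|S| <= #|S'| + 2 * m)%N &
        expander E S' /\ linked E S'].
Proof.
move=> jE hP cS; pose rest X := finset.cover (pairs_avoiding P X).
have restS (X Y : {set T}) : X \subset Y -> rest Y \subset rest X.
  move=> XY; apply/finset.bigcupsP => e; rewrite inE => /andP [eP dY].
  apply: finset.bigcup_sup; rewrite inE eP.
  by rewrite disjoint_sym in dY; rewrite disjoint_sym (disjointWl XY dY).
have restX (X : {set T}) x : x \in X -> x \in rest X -> False.
  move=> xX /finset.bigcupP [e]; rewrite inE => /andP [eP /pred0P /(_ x) /=].
  by rewrite xX andbT => ->.
pose bad := [pred X : {set T} | (#|X| <= m)%N && (#|ext_nbrs E (rest X) X| <= 2 * #|X|)%N].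
have bad0 : bad finset.set0.
  rewrite /= cards0 /= leqn0 cards_eq0 -finset.subset0.
  by apply/fintype.subsetP => x; rewrite inE => /andP [_ /exists_inP [y]]; rewrite inE.
have [X /maxsetP [/andP [cX bX] maxX] _] := maxset_exists bad0.
have sP : pairs_avoiding P X \subset P by apply/fintype.subsetP => e; rewrite inE => /andP [].
have [hP' S'S cS'] := sub_set_pairing hP sP.
have cSX := card_cover_avoiding X hP.
have cSm : (#|S| <= #|rest X| + 2 * m)%N by rewrite /rest; lia.
suff hE : expander E (rest X).
  exists (rest X), (pairs_avoiding P X); split=> //; split=> //.
  by apply: joined_linked jE _ hE; lia.
move=> Y YS Y0 cY; rewrite ltnNge; apply/negP => bY.
(* A poorly expanding [Y] with more than [m] vertices would give [#|rest X| < 3 * #|Y| + m], hence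
   fewer than [4 * m] vertices, while at least [7 * m] remain. *)
have [lt_mY|le_Ym] := ltnP m #|Y|.
  have := joined_ext_nbrs (rest X) jE (ltnW lt_mY).
  by rewrite (finset.setIidPr YS); lia.
have XY0 : (X :&: Y)%SET = finset.set0.
  apply/eqP; rewrite -finset.subset0; apply/fintype.subsetP => x.
  by rewrite inE => /andP [xX /(fintype.subsetP YS) /(restX _ _ xX)].
have cXY : #|(X :|: Y)%SET| = (#|X| + #|Y|)%N by rewrite cardsU XY0 cards0 subn0.
have sub : ext_nbrs E (rest (X :|: Y)%SET) (X :|: Y)%SET \subset
    (ext_nbrs E (rest X) X :|: ext_nbrs E (rest X) Y)%SET.
  apply/fintype.subsetP => y; rewrite inE => /andP [/finset.setDP [yR yXY]].
  have yX := fintype.subsetP (restS _ _ (finset.subsetUl X Y)) y yR.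
  move: yXY; rewrite inE negb_or => /andP [nX nY].
  case/exists_inP=> x; rewrite inE => /orP [] xX exy; apply/finset.setUP.
    by left; rewrite !inE nX yX; apply/exists_inP; exists x.
  by right; rewrite !inE nY yX; apply/exists_inP; exists x.
have bXY : (#|ext_nbrs E (rest (X :|: Y)%SET) (X :|: Y)%SET| <= 2 * #|(X :|: Y)%SET|)%N.
  rewrite cXY; have := subset_leq_card sub.
  by have [+ _] := leq_card_setU (ext_nbrs E (rest X) X) (ext_nbrs E (rest X) Y); lia.
have cY0 : (0 < #|Y|)%N by rewrite card_gt0.
have [le_m|lt_m] := leqP #|(X :|: Y)%SET| m.
  have /maxX := finset.subsetUl X Y; rewrite /bad /= le_m bXY => /(_ isT) XYX.
  by move: cXY; rewrite XYX; lia.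
(* Here the union has at most [2 * m] vertices. Fewer than [5 * m] vertices would remain, yet
   [9 * m - 4 * m] do: this is the source of the 9. *)
have := joined_ext_nbrs (rest (X :|: Y)%SET) jE (ltnW lt_m).
have -> : (rest (X :|: Y) :&: (X :|: Y))%SET = finset.set0.
  apply/eqP; rewrite -finset.subset0; apply/fintype.subsetP => x.
  by rewrite inE => /andP [xR xX]; have := restX _ _ xX xR.
rewrite cards0; have := card_cover_avoiding (X :|: Y)%SET hP; rewrite -/(rest _).
lia.
Qed.

(** * Expectations over the random graph *)

Lemma sum_powerset_prod (R : comRingType) (T : finType) (D : {set T}) (F G : T -> R) :
  \sum_(E in powerset D) \prod_(e in D) (if e \in E then F e else G e) =
  \prod_(e in D) (F e + G e).
Proof.
rewrite [RHS]big_mkcond /=.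
(* Outside [D] the values 0 and 1 kill every set that is not contained in [D], so the expansion over
   all subsets of the type applies. *)
pose F' e := if e \in D then F e else 0; pose G' e := if e \in D then G e else 1.
transitivity (\prod_e (F' e + G' e)); last first.
  by apply: eq_bigr => e _; rewrite /F' /G'; case: ifP => // _; rewrite add0r.
rewrite bigA_distr big_mkcond /=; apply: eq_bigr => E _; rewrite powersetE.
case: ifP => [ED|/negbT/subsetPn [e eE eD]].
  rewrite big_mkcond /=; apply: eq_bigr => e _; rewrite /F' /G'.
  by case: (boolP (e \in D)) => // eD; rewrite (negbTE (contra (fintype.subsetP ED e) eD)).
by rewrite (bigD1 e) //= /F' eE (negbTE eD) mul0r.
Qed.

Lemma sum_powerset_expr (R : comRingType) (T : finType) (D : {set T}) (x : R) :
  \sum_(F in powerset D) x ^+ #|F| = (1 + x) ^+ #|D|.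
Proof.
transitivity (\prod_(e in D) (x + 1)); last by rewrite prodr_const addrC.
rewrite -sum_powerset_prod; apply: eq_bigr => F; rewrite powersetE => FD.
rewrite -prodr_const big_mkcond /= [RHS]big_mkcond /=; apply: eq_bigr => e _.
case: (boolP (e \in F)) => [/(fintype.subsetP FD) -> //|_].
by case: ifP.
Qed.

Definition gnp_exp (R : realType) (n : nat) (q : R) (f : {set {set 'I_n}} -> R) : R :=
  \sum_(E in powerset (vpairs 'I_n)) gnp_weight q E * f E.

Lemma gnp_weight_ge0 (R : realType) (n : nat) (q : R) (E : {set {set 'I_n}}) :
  0 <= q <= 1 -> 0 <= gnp_weight q E.
Proof. by move=> q01; apply: prodr_ge0 => e _; case: ifP => _; lra. Qed.

Lemma gnp_exp_le (R : realType) (n : nat) (q : R) (f g : {set {set 'I_n}} -> R) :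
  0 <= q <= 1 -> (forall E : {set {set 'I_n}}, E \subset vpairs 'I_n -> f E <= g E) ->
  gnp_exp q f <= gnp_exp q g.
Proof.
move=> q01 fg; apply: ler_sum => E; rewrite powersetE => ED.
by apply: ler_wpM2l; [exact: gnp_weight_ge0 | exact: fg].
Qed.

Lemma gnp_expD (R : realType) (n : nat) (q : R) (f g : {set {set 'I_n}} -> R) :
  gnp_exp q (fun E => f E + g E) = gnp_exp q f + gnp_exp q g.
Proof. by rewrite -big_split; apply: eq_bigr => E _; rewrite mulrDr. Qed.

Lemma gnp_exp_sum (R : realType) (n : nat) (q : R) (I : Type) (r : seq I) (P : pred I)
    (f : I -> {set {set 'I_n}} -> R) :
  gnp_exp q (fun E => \sum_(i <- r | P i) f i E) = \sum_(i <- r | P i) gnp_exp q (f i).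
Proof.
by rewrite exchange_big /=; apply: eq_bigr => E _; rewrite mulr_sumr.
Qed.

Lemma gnp_exp_cst (R : realType) (n : nat) (q c : R) :
  gnp_exp q (fun _ : {set {set 'I_n}} => c) = c.
Proof.
rewrite /gnp_exp -mulr_suml sum_powerset_prod big1 ?mul1r // => e _.
by rewrite addrC subrK.
Qed.

(** Two-round exposure. For each outcome [E] of the union, the indicator factorises over pairs. A
    pair in [E] contributes [q + (1 - q) * q = p], a pair outside it [(1 - q)^2 = 1 - p]. *)
Lemma gnp_exp_union (R : realType) (n : nat) (p q : R) (f : {set {set 'I_n}} -> R) :
  1 - p = (1 - q) ^+ 2 ->
  gnp_exp p f = gnp_exp q (fun E1 => gnp_exp q (fun E2 => f (E1 :|: E2)%SET)).
Proof.
move=> pq; set D := vpairs 'I_n.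
pose w := @gnp_weight R n q.
transitivity (\sum_(E1 in powerset D) \sum_(E2 in powerset D) \sum_(E in powerset D)
    (w E1 * (w E2 * (E1 :|: E2 == E)%SET%:R)) * f E); last first.
  apply: eq_bigr => E1; rewrite powersetE => E1D; rewrite mulr_sumr.
  apply: eq_bigr => E2; rewrite powersetE => E2D.
  rewrite (bigD1 (E1 :|: E2)%SET) ?powersetE ?finset.subUset ?E1D //= eqxx mulr1.
  rewrite big1 ?addr0 ?mulrA // => E /andP [_ /negbTE nE].
  by rewrite eq_sym nE !mulr0 mul0r.
have -> : \sum_(E1 in powerset D) \sum_(E2 in powerset D) \sum_(E in powerset D)
    (w E1 * (w E2 * (E1 :|: E2 == E)%SET%:R)) * f E =
  \sum_(E in powerset D) (\sum_(E1 in powerset D) w E1 *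
    \sum_(E2 in powerset D) w E2 * (E1 :|: E2 == E)%SET%:R) * f E.
  rewrite (eq_bigr (fun E1 => \sum_(E in powerset D) \sum_(E2 in powerset D)
    (w E1 * (w E2 * (E1 :|: E2 == E)%SET%:R)) * f E)); last by move=> E1 _; apply: exchange_big.
  rewrite exchange_big /=; apply: eq_bigr => E _; rewrite mulr_suml.
  by apply: eq_bigr => E1 _; rewrite mulr_sumr mulr_suml.
apply: eq_bigr => E; rewrite powersetE => ED; congr (_ * _).
(* The factor at [e] after summing over [E2]: if [e] is in [E2] it must be in [E], and otherwise
   [E1] and [E] must agree at [e]. *)
transitivity (\sum_(E1 in powerset D) w E1 * \prod_(e in D)
    (q * (e \in E)%:R + (1 - q) * ((e \in E1) == (e \in E))%:R)); last first.
  apply: eq_bigr => E1; rewrite powersetE => E1D; congr (_ * _).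
  rewrite -sum_powerset_prod; apply: eq_bigr => E2; rewrite powersetE => E2D.
  have -> : (E1 :|: E2 == E)%SET%:R =
      \prod_(e in D) (((e \in E1) || (e \in E2)) == (e \in E))%:R :> R.
    case: eqVneq => [<-|].
      by rewrite big1 // => e _; rewrite inE eqxx.
    move=> neq; have [e eD ne] : exists2 e, e \in D &
        ((e \in E1) || (e \in E2)) != (e \in E).
      apply/exists_inP; apply: contraNT neq => /exists_inPn h.
      apply/eqP/setP => e; rewrite inE; case: (boolP (e \in D)) => [/h|eD].
        by rewrite negbK => /eqP.
      by rewrite !(negbTE (contra (fintype.subsetP _ e) eD)).
    by rewrite (bigD1 e) //= (negbTE ne) mul0r.
  rewrite -big_split /=; apply: eq_bigr => e _.
  by case: (e \in E2); rewrite ?orbT ?orbF // eq_sym eqb_id.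
rewrite [RHS](eq_bigr (fun E1 : {set {set 'I_n}} => \prod_(e in D) (if e \in E1 then q * (e \in E)%:R
    else (1 - q) * (q * (e \in E)%:R + (1 - q) * (~~ (e \in E))%:R)))); last first.
  move=> E1 _; rewrite -big_split /=; apply: eq_bigr => e _.
  by case: (e \in E1); case: (e \in E) => /=; ring.
rewrite sum_powerset_prod; apply: eq_bigr => e _.
case: (e \in E) => /=; last by rewrite pq; ring.
by rewrite -[p in LHS](subKr 1) pq; ring.
Qed.

(** Independence of the pairs. This is only an inequality because [F] and [B] may share a pair,
    which makes the event impossible. *)
Lemma gnp_exp_contains_avoids (R : realType) (n : nat) (q : R) (F B : {set {set 'I_n}}) :
  0 <= q <= 1 -> F \subset vpairs 'I_n -> B \subset vpairs 'I_n ->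
  gnp_exp q (fun E => ((F \subset E) && [disjoint E & B])%:R) <=
  q ^+ #|F| * (1 - q) ^+ #|B|.
Proof.
move=> q01 FD BD; set D := vpairs 'I_n.
pose h (E : {set {set 'I_n}}) : R := \prod_(e in D)
  (if e \in E then (e \notin B)%:R else (e \notin F)%:R).
apply: le_trans (gnp_exp_le q01 (g := h) _) _.
  move=> E ED; case: (boolP (_ && _)) => [/andP [FE EB]|_]; last first.
    by apply: prodr_ge0 => e _; case: ifP.
  rewrite /h big1 // => e eD; case: ifP => [eE|/negbT eE].
    by rewrite (negbT (disjointFr EB eE)).
  by rewrite (contra (fintype.subsetP FE e) eE).
rewrite /gnp_exp (eq_bigr (fun E : {set {set 'I_n}} => \prod_(e in D)
    (if e \in E then q * (e \notin B)%:R else (1 - q) * (e \notin F)%:R))); last first.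
  by move=> E _; rewrite -big_split /=; apply: eq_bigr => e _; case: ifP.
rewrite sum_powerset_prod.
have -> : q ^+ #|F| * (1 - q) ^+ #|B| = \prod_(e in D)
    ((if e \in F then q else 1) * (if e \in B then 1 - q else 1)).
  rewrite big_split -!prodr_const; congr (_ * _).
    rewrite big_mkcond /= [RHS]big_mkcond /=; apply: eq_bigr => e _.
    by case: (boolP (e \in F)) => [/(fintype.subsetP FD) -> //|_]; case: ifP.
  rewrite big_mkcond /= [RHS]big_mkcond /=; apply: eq_bigr => e _.
  by case: (boolP (e \in B)) => [/(fintype.subsetP BD) -> //|_]; case: ifP.
apply: ler_prod => e _; have q0 : 0 <= q * (1 - q) by apply: mulr_ge0; lra.
by case: (e \in F); case: (e \in B) => /=; lra.
Qed.

(** * The union bound and the two failure probabilities *)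

Lemma indicator_le_sum (R : realType) (I : finType) (b : bool) (P c : pred I) :
  (b -> exists2 i, P i & c i) -> b%:R <= \sum_(i | P i) (c i)%:R :> R.
Proof.
case: b => [/(_ isT) [i Pi ci]|_]; last by apply: sumr_ge0.
by rewrite (bigD1 i) //= ci lerDl; apply: sumr_ge0.
Qed.

Lemma exp2_le_expR (R : realType) (k : nat) : 2 ^+ k <= expR (k%:R : R).
Proof.
rewrite -[k%:R]mul1r expRM_natr; apply: lerXn2r; rewrite ?nnegrE ?expR_ge0 //.
by apply: le_trans (expR_ge1Dx 1); lra.
Qed.

Lemma onem_exp_le_expR (R : realType) (q : R) (k : nat) :
  q <= 1 -> (1 - q) ^+ k <= expR (- (q * k%:R)).
Proof.
move=> q1; rewrite -mulNr expRM_natr; apply: lerXn2r; rewrite ?nnegrE ?expR_ge0 //; first lra.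
exact: expR_ge1Dx.
Qed.

Lemma add1_exp_le_expR (R : realType) (x : R) (k : nat) :
  0 <= x -> (1 + x) ^+ k <= expR (x * k%:R).
Proof.
move=> x0; rewrite expRM_natr; apply: lerXn2r; rewrite ?nnegrE ?expR_ge0 //; first lra.
exact: expR_ge1Dx.
Qed.

Lemma card_set_ord (n : nat) : #|{: {set 'I_n}}| = (2 ^ n)%N.
Proof. by rewrite -cardsT -powersetT card_powerset cardsT card_ord. Qed.

Definition cross_pairs (T : finType) (A B : {set T}) : {set {set T}} :=
  [set [set x; y] | x in A, y in B]%SET.

Lemma card_cross_pairs (T : finType) (A B : {set T}) :
  [disjoint A & B] -> #|cross_pairs A B| = (#|A| * #|B|)%N.
Proof.
move=> dAB; have nAB x y : x \in A -> y \in B -> x != y.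
  by move=> xA yB; apply: contraNneq (negbT (disjointFr dAB xA)) => ->.
rewrite -cardsX -(card_in_imset (f := fun p : T * T => [set p.1; p.2]%SET)).
  congr #|pred_of_set _|; apply/setP => e; apply/imset2P/imsetP.
    by case=> x y xA yB ->; exists (x, y) => //; rewrite !inE xA yB.
  by case=> [[x y]]; rewrite !inE => /andP [xA yB] ->; exists x y.
move=> [x y] [x' y']; rewrite !inE /= => /andP [xA yB] /andP [xA' yB'] /setP e.
have := e x; rewrite !inE eqxx /= (negbTE (nAB _ _ xA yB')) orbF => /esym/eqP <-.
have := e y; rewrite !inE eqxx orbT /= eq_sym (negbTE (nAB _ _ xA' yB)) /=.
by move=> /esym/eqP <-.
Qed.

(** Union bound over at most [4^n] pairs of sets. Each failure requires at least [m^2] cross pairs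
    to be absent. *)
Lemma gnp_not_joined (R : realType) (n m : nat) (q : R) : 0 <= q <= 1 ->
  gnp_exp q (fun E : {set {set 'I_n}} => (~~ `[< joined E m >])%:R) <=
  4 ^+ n * (1 - q) ^+ (m * m).
Proof.
move=> q01.
pose C (p : {set 'I_n} * {set 'I_n}) :=
  [&& [disjoint p.1 & p.2], (m <= #|p.1|)%N & (m <= #|p.2|)%N].
apply: le_trans (gnp_exp_le q01 (g := fun E => \sum_(p | C p)
    ((finset.set0 \subset E) && [disjoint E & cross_pairs p.1 p.2])%:R) _) _.
  move=> E _; apply: indicator_le_sum; apply: contraNP => nC; apply/asboolP => A B dAB cA cB.
  apply: contra_notP nC => nE; exists (A, B); first by rewrite /C dAB cA cB.
  rewrite finset.sub0set /=; apply/pred0P => e; apply/negbTE/negP => /andP [/= eE].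
  by case/imset2P=> x y xA yB eE'; apply: nE; exists x, y; split=> //; rewrite /adj -eE'.
rewrite gnp_exp_sum; apply: le_trans (_ : \sum_(p : {set 'I_n} * {set 'I_n}) (1 - q) ^+ (m * m) <= _).
  rewrite [leRHS](bigID C) /=; apply: ler_wpDr; first by apply: sumr_ge0 => *; apply: exprn_ge0; lra.
  apply: ler_sum => -[A B] /and3P [/= dAB cA cB].
  apply: le_trans (gnp_exp_contains_avoids q01 (finset.sub0set _) _) _.
    apply/fintype.subsetP => _ /imset2P [x y xA yB ->]; rewrite inE cards2.
    by rewrite (contraNneq _ (negbT (disjointFr dAB xA))) // => ->.
  rewrite cards0 expr0 mul1r card_cross_pairs //.
  by apply: ler_wiXn2l; rewrite ?leq_mul //; lra.
rewrite sumr_const card_prod !card_set_ord -expnMn -[leLHS]mulr_natl natrX.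
by [].
Qed.

Lemma card_induced_vpairs (T : finType) (A : {set T}) :
  (2 * #|induced_edges (vpairs T) A| <= #|A| * #|A|)%N.
Proof.
have -> : #|induced_edges (vpairs T) A| = 'C(#|A|, 2).
  by rewrite -cards_draws; congr #|pred_of_set _|; apply/setP => e; rewrite !inE andbC.
rewrite bin2; apply: leq_trans (_ : #|A| * #|A|.-1 <= _)%N; last by rewrite leq_mul2l leq_pred orbT.
by lia.
Qed.

Definition has_hamilton_path (T : finType) (E : {set {set T}}) (A : {set T}) : bool :=
  `[< exists s, is_hamilton_path A (induced_edges E A) s >].

(** With [a = #|A|], the absent boosters contribute [- q * a^2 / 32] to the exponent, the sum over
    [F] costs [q * a^2 / 64], and the factor [32^a = 2^(5 * a)] costs [5 * a]. *)
Lemma gnp_not_hamilton (R : realType) (n : nat) (q : R) (E1 : {set {set 'I_n}})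
    (A : {set 'I_n}) : 0 <= q <= 1 ->
  (4 <= #|A|)%N -> expander E1 A -> linked E1 A ->
  gnp_exp q (fun E2 => (~~ has_hamilton_path (E1 :|: E2)%SET A)%:R) <=
  expR (5 * #|A|%:R - q * #|A|%:R ^+ 2 / 64).
Proof.
move=> q01 cA hE lE; set D := induced_edges (vpairs 'I_n) A; set a : R := #|A|%:R.
have q0 : 0 <= q by case/andP: q01.
pose C (F : {set {set 'I_n}}) := (F \in powerset D) && (#|F| <= #|A|)%N.
have Dv : D \subset vpairs 'I_n by apply/fintype.subsetP => e; rewrite inE => /andP [].
apply: le_trans (gnp_exp_le q01 (g := fun E2 => \sum_(F | C F)
    ((F \subset E2) && [disjoint E2 & boosters (E1 :|: F)%SET A])%:R) _) _.
  move=> E2 _; apply: indicator_le_sum => /asboolPn noH.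
  have [|F [FD cF FE2 dF]] := no_hamilton_boosters (E2 := E2) lE.
    by move=> s hs; apply: noH; exists s.
  by exists F; rewrite /C ?powersetE ?FD ?cF // FE2 dF.
rewrite gnp_exp_sum.
apply: le_trans (_ : \sum_(F in powerset D) (q / 32) ^+ #|F| *
    (32 ^+ #|A| * expR (- (q * a ^+ 2 / 32))) <= _).
  rewrite [leRHS](bigID (fun F : {set {set 'I_n}} => #|F| <= #|A|)%N) /=.
  apply: ler_wpDr.
    apply: sumr_ge0 => F _; apply: mulr_ge0; first by apply: exprn_ge0; lra.
    by apply: mulr_ge0; rewrite ?expR_ge0 ?exprn_ge0.
  (* [q ^ |F| <= 32 ^ |A| * (q / 32) ^ |F|] because [|F| <= |A|]; the factor
     [1 / 32] makes the sum over [F] smaller than the gain from the boosters. *)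
  apply: ler_sum => F /andP []; rewrite powersetE => FD cF.
  set B := boosters (E1 :|: F)%SET A.
  have Bv : B \subset vpairs 'I_n by apply/fintype.subsetP => e; rewrite inE => /andP [].
  apply: le_trans (gnp_exp_contains_avoids q01 (fintype.subset_trans FD Dv) Bv) _.
  rewrite mulrA; apply: ler_pM; rewrite ?exprn_ge0 //; first lra.
    rewrite expr_div_n -mulrA ler_peMr ?exprn_ge0 // mulrC ler_pdivlMr ?exprn_gt0 //.
    by rewrite mul1r ler_weXn2l // ler1n.
  apply: le_trans (onem_exp_le_expR _ _) _; first lra.
  rewrite ler_expR lerN2 -mulrA ler_wpM2l // ler_pdivrMr // -natrX -natrM ler_nat.
  rewrite mulnC -mulnn; apply: card_boosters => //.
  exact: expander_mono (finset.subsetUl _ _) hE.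
rewrite -mulr_suml sum_powerset_expr.
apply: le_trans (_ : expR (q * a ^+ 2 / 64) * (expR (5 * a) * expR (- (q * a ^+ 2 / 32))) <= _).
  apply: ler_pM; rewrite ?exprn_ge0 ?mulr_ge0 ?expR_ge0 ?exprn_ge0 //; first lra.
    apply: le_trans (add1_exp_le_expR _ _) _; first lra.
    rewrite ler_expR -[leRHS]mulrA -[leLHS]mulrA ler_wpM2l // mulrC ler_pdivlMr // -mulrA.
    rewrite (_ : 32^-1 * 64 = 2); last by lra.
    by rewrite -natrX -natrM ler_nat mulnC -mulnn card_induced_vpairs.
  rewrite ler_wpM2r ?expR_ge0 // (_ : 32 = 2 ^+ 5); last by rewrite -natrX.
  by rewrite -exprM /a -natrM; apply: exp2_le_expR.
rewrite -!expRD ler_expR; lra.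
Qed.

(** * Combining the estimates and choosing the parameters *)

Lemma gnp_prob_exp (R : realType) (n : nat) (p : R) (X : set {set {set 'I_n}}) :
  gnp_prob p X = gnp_exp p (fun E => (E \in X)%:R).
Proof.
rewrite /gnp_prob /gnp_exp big_mkcondr /=; apply: eq_bigr => E _.
by case: (E \in X); rewrite ?mulr1 ?mulr0.
Qed.

Lemma gnp_prob_setC (R : realType) (n : nat) (p : R) (X : set {set {set 'I_n}}) :
  1 - gnp_prob p X = gnp_exp p (fun E => (E \notin X)%:R).
Proof.
apply/eqP; rewrite subr_eq gnp_prob_exp -gnp_expD -[X in X == _](gnp_exp_cst n p); apply/eqP.
by apply: eq_bigr => E _; case: (E \in X); rewrite /= ?addr0 ?add0r.
Qed.

Definition subpairing_property (n k : nat) (E : {set {set 'I_n}}) : Prop :=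
  forall (S : {set 'I_n}) (P : {set {set 'I_n}}),
    is_set_pairing S P -> (k <= #|S|)%N ->
    exists (S' : {set 'I_n}) (P' : {set {set 'I_n}}),
      [/\ is_set_pairing S' P', S' \subset S, P' \subset P, S' != finset.set0
        & exists s : seq 'I_n, is_hamilton_path S' (induced_edges E S') s].

(** Each of the two failures has probability at most [expR (- n)]: for [joined], [4^n] is beaten by
    [expR (- 4 * n)]; for the Hamilton paths, [2^n] choices of [A] are beaten by
    [expR (- 2 * n)]. *)
Lemma gnp_subpairing (R : realType) (n m : nat) (p q : R) (X : set {set {set 'I_n}}) :
  0 <= p <= 1 -> 0 <= q <= 1 -> 1 - p = (1 - q) ^+ 2 ->
  4 * n%:R <= q * m%:R ^+ 2 -> 10 <= q * m%:R ->
  (forall E : {set {set 'I_n}}, subpairing_property (100 * m) E -> X E) ->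
  1 - 2 * expR (- n%:R) <= gnp_prob p X.
Proof.
move=> p01 q01 pq nm qm hX.
have [q0 q1] := andP q01.
have m_gt0 : (0 < m)%N by rewrite lt0n; apply/eqP => m0; rewrite m0 mulr0 in qm; lra.
have m1 : 1 <= m%:R :> R by rewrite ler1n.
(* Of the [100 * m] vertices at most [2 * m] are lost. The range of the union bound depends on [E1]
   alone, so it is fixed before [E2] is exposed. *)
pose C E1 (A : {set 'I_n}) :=
  `[< [/\ (98 * m <= #|A|)%N, expander E1 A & linked E1 A] >].
have le_bad E1 E2 : (E1 :|: E2 \notin X)%SET%:R <= (~~ `[< joined E1 m >])%:R +
    \sum_(A | C E1 A) (~~ has_hamilton_path (E1 :|: E2)%SET A)%:R :> R.
  case: (boolP `[< joined E1 m >]) => [/asboolP jE|_] /=; last first.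
    by apply: ler_wpDr; rewrite ?sumr_ge0 // lern1 leq_b1.
  rewrite add0r; apply: indicator_le_sum => nX.
  apply: contrapT => noA; move/negP: nX; apply; rewrite inE; apply: hX => S P hP cS.
  have [|S' [P' [hP' S'S P'P cS' [eS' lS']]]] := expanding_subpairing jE hP.
    by apply: leq_trans cS; rewrite leq_mul2r orbT.
  have cA : (98 * m <= #|S'|)%N.
    by rewrite -(leq_add2r (2 * m)) -mulnDl; apply: leq_trans cS cS'.
  exists S', P'; split=> //; first by rewrite -card_gt0; apply: leq_trans cA; rewrite muln_gt0.
  apply: contrapT => nH; apply: noA; exists S'; first exact/asboolP.
  by apply/asboolPn.
have le_inner E1 : gnp_exp q (fun E2 => (E1 :|: E2 \notin X)%SET%:R) <=
    (~~ `[< joined E1 m >])%:R + expR (- n%:R).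
  apply: le_trans (gnp_exp_le q01 (fun E2 _ => le_bad E1 E2)) _.
  rewrite gnp_expD gnp_exp_cst lerD2l gnp_exp_sum.
  apply: le_trans (_ : \sum_(A : {set 'I_n}) expR (- (2 * n%:R)) <= _).
    rewrite [leRHS](bigID (C E1)) /=; apply: ler_wpDr.
      by apply: sumr_ge0 => A _; apply: expR_ge0.
    apply: ler_sum => A /asboolP [cA hE lE].
    apply: le_trans (gnp_not_hamilton q01 _ hE lE) _; first by lia.
    rewrite ler_expR.
    have : (98 * m)%:R <= #|A|%:R :> R by rewrite ler_nat.
    rewrite natrM; set a : R := #|A|%:R => ma.
    (* Since [q * a >= 980], the term [5 * a] takes up only part of [q * a^2 / 64]; the remainder
       exceeds [2 * n] because [q * m^2 >= 4 * n]. *)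
    have qa : 980 <= q * a.
      by apply: le_trans (_ : q * (98 * m%:R) <= _); [lra | exact: ler_wpM2l].
    have qa2 : q * (98 * m%:R) ^+ 2 <= q * a ^+ 2.
      by apply: ler_wpM2l => //; apply: lerXn2r; rewrite ?nnegrE //; lra.
    have qaa : 980 * a <= q * a ^+ 2.
      by rewrite expr2 mulrA; apply: ler_wpM2r => //; lra.
    have n0 : 0 <= n%:R :> R by [].
    rewrite exprMn mulrCA in qa2; lra.
  rewrite sumr_const card_set_ord -[leLHS]mulr_natl natrX.
  apply: le_trans (_ : expR n%:R * expR (- (2 * n%:R)) <= _).
    by rewrite ler_wpM2r ?expR_ge0 // exp2_le_expR.
  by rewrite -expRD ler_expR; lra.
rewrite lerBlDr -lerBlDl gnp_prob_setC (gnp_exp_union _ pq).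
apply: le_trans (gnp_exp_le q01 (fun E1 _ => le_inner E1)) _.
rewrite gnp_expD gnp_exp_cst mulrDl mul1r lerD2r.
apply: le_trans (gnp_not_joined n m q01) _.
apply: le_trans (_ : expR (2 * n%:R) * expR (- (4 * n%:R)) <= _).
  apply: ler_pM; rewrite ?exprn_ge0 //; first lra.
    rewrite (_ : 4 = 2 ^+ 2); last by rewrite -natrX.
    by rewrite -exprM -natrM; apply: exp2_le_expR.
  apply: le_trans (onem_exp_le_expR _ q1) _.
  by rewrite ler_expR lerN2 natrM -expr2.
have n0 : 0 <= n%:R :> R by [].
by rewrite -expRD ler_expR; lra.
Qed.

Theorem theorem2p3 (R : realType) (omega : nat -> R)
    (omega_le : forall n : nat, (0 < n)%N -> omega n <= n%:R)
    (omega_infty : (omega n @[n --> \oo] --> +oo)%classic) :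
  aas (fun n => omega n / n%:R)
    (fun n E =>
       forall (S : {set 'I_n}) (P : {set {set 'I_n}}),
         is_set_pairing S P ->
         510 * n%:R / Num.sqrt (omega n) <= #|S|%:R ->
         exists (S' : {set 'I_n}) (P' : {set {set 'I_n}}),
           [/\ is_set_pairing S' P', S' \subset S, P' \subset P, S' != finset.set0
             & exists s : seq 'I_n,
                 is_hamilton_path S' (induced_edges E S') s]).
Proof.
rewrite /aas; apply: (@squeeze_cvgr _ _ _ _ (fun n => 1 - 2 * expR (-1) ^+ n) (fun=> 1)).
- near=> n.
  have n_gt0 : (0 < n)%N by near: n; exists 1%N.
  (* This gives [r >= 7] for the root [r] of [omega n], so that [q * m >= 3 * r / 2 >= 10] below. *)
  have w49 : 49 <= omega n by near: n; move/cvgryPge: omega_infty; apply.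
  have wn := omega_le n n_gt0.
  set N : R := n%:R; set w := omega n in w49 wn *; set p := w / N.
  have N1 : 1 <= N by rewrite ler1n.
  have N0 : 0 < N by lra.
  have p01 : 0 <= p <= 1.
    by rewrite /p divr_ge0 ?ler_pdivrMr ?mul1r //; lra.
  apply/andP; split; last first.
    rewrite gnp_prob_exp -[leRHS](gnp_exp_cst n p).
    by apply: gnp_exp_le => // E _; case: (E \in _).
  (* The solution of [1 - p = (1 - q)^2] in the unit interval; it satisfies [q >= p / 2]. *)
  set q := 1 - Num.sqrt (1 - p).
  have s0 : 0 <= Num.sqrt (1 - p) by apply: sqrtr_ge0.
  have s2 : Num.sqrt (1 - p) ^+ 2 = 1 - p by rewrite sqr_sqrtr //; lra.
  have q01 : 0 <= q <= 1 by rewrite /q; apply/andP; split; nra.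
  have pq2 : p / 2 <= q by rewrite /q; nra.
  set r := Num.sqrt w.
  have r2 : r ^+ 2 = w by rewrite sqr_sqrtr //; lra.
  have r0 : 0 <= r by apply: sqrtr_ge0.
  have r7 : 7 <= r by rewrite -(ler_pXn2r (n := 2)) ?nnegrE // r2; lra.
  have rN : r <= N by nra.
  (* With [m] just above [x], rounding costs at most 1, and [r <= N] gives
     [100 * (x + 1) <= 400 * N / r], within the allowed [510 * N / r]. *)
  pose x := 3 * N / r.
  have x0 : 0 <= x by rewrite /x divr_ge0 //; lra.
  have xr : x * r = 3 * N by rewrite /x divfK //; lra.
  have [mx xm] := andP (truncn_itv x0).
  set m := (Num.trunc x).+1 in xm.
  have mx1 : m%:R <= x + 1 by rewrite /m -natr1; lra.
  have pN : p * N = r ^+ 2 by rewrite r2 /p divfK //; lra.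
  have m_large : 3 * N <= m%:R * r by rewrite -xr; apply: ler_wpM2r => //; lra.
  have m_small : 100 * m%:R <= 510 * N / r.
    by rewrite ler_pdivlMr; nra.
  rewrite -expRM_natr mulN1r.
  apply: (gnp_subpairing (m := m) (q := q)) => //.
  + by rewrite /q subKr s2.
  (* Squaring [m * r >= 3 * N] and using [r^2 = p * N] gives [p * m^2 >= 9 * N], hence
     [q * m^2 >= 9 * N / 2]. *)
  + have : (3 * N) ^+ 2 <= (m%:R * r) ^+ 2 by apply: lerXn2r; rewrite ?nnegrE ?mulr_ge0 //; lra.
    rewrite [leRHS]exprMn -pN => h.
    have h' : 9 * N <= m%:R ^+ 2 * p.
      by rewrite -(ler_pM2r N0); nra.
    have mm : 0 <= m%:R ^+ 2 :> R by apply: exprn_ge0.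
    nra.
  + have h : 3 * r <= m%:R * p.
      have h1 : 3 * N * r <= m%:R * r * r by apply: ler_wpM2r.
      have e : m%:R * p * N = m%:R * r * r by rewrite -mulrA pN expr2 mulrA.
      by rewrite -(ler_pM2r N0) e; lra.
    have mm : 0 <= m%:R :> R by [].
    nra.
  move=> E hE S P hP cS; apply: hE => //.
  by rewrite -(ler_nat R) natrM; apply: le_trans m_small cS.
- rewrite -[X in (_ --> X)%classic]subr0; apply: cvgB; first exact: cvg_cst.
  apply: (cvg_geometric 2); rewrite ger0_norm ?expR_ge0 // -expR0 ltr_expR; lra.
- exact: cvg_cst.
Unshelve. all: by end_near.
Qed.
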